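(* Let $n$ be a positive integer and $z$ a real number with $0<|z|\le1$. Then \[ \sqrt5\sum_{k=1}^\infty\frac{(-1)^{k-1}F_{2k}\zeta(2k)z^{2k}}{k(2k+n)} = \frac{\pi z}{n+1}-\frac{2\ln\alpha}{n}+\frac{2(n-1)!\sinh(n\ln\alpha)}{(2\pi z)^n}\zeta(n+1) -(n-1)!\sum_{j=1}^n\frac{\alpha^j\operatorname{Li}_{j+1}(e^{2\pi\beta z})-(-\beta)^j\operatorname{Li}_{j+1}(e^{-2\pi\alpha z})}{(n-j)!\,(2\pi z)^j}, \] \[ \sum_{k=1}^\infty\frac{(-1)^{k-1}L_{2k}\zeta(2k)z^{2k}}{k(2k+n)} = \frac{\sqrt5\pi z}{n+1}-\frac{2\ln(2\pi z)}{n}-\frac{2(n-1)!\cosh(n\ln\alpha)}{(2\pi z)^n}\zeta(n+1)+\frac{2}{n^2} +(n-1)!\sum_{j=1}^n\frac{\alpha^j\operatorname{Li}_{j+1}(e^{2\pi\beta z})+(-\beta)^j\operatorname{Li}_{j+1}(e^{-2\pi\alpha z})}{(n-j)!\,(2\pi z)^j}. \]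
   Context: $F_n$ and $L_n$ are the Fibonacci and Lucas numbers ($F_0=0,F_1=1$, $L_0=2,L_1=1$, $w_n=w_{n-1}+w_{n-2}$), so $F_n=(\alpha^n-\beta^n)/(\alpha-\beta)$ and $L_n=\alpha^n+\beta^n$ with $\alpha=(1+\sqrt5)/2$, $\beta=(1-\sqrt5)/2$. $\zeta$ is the Riemann zeta function and $\operatorname{Li}_s(x)=\sum_{k\ge1}x^k/k^s$ the polylogarithm.
   Formalization: Proved for 0 < z ≤ 1 only (for z < 0 the series Li at e^{2πβz} > 1 diverges and ln(2πz) is not real), and each identity assumes its left-hand series converges, i.e. αz ≤ 1; for 1/α < z ≤ 1 that series diverges and the claim fails. *)

(* Defs.v *)
From Stdlib Require Import Reals.
From Coquelicot Require Import Coquelicot.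
Open Scope R_scope.

Fixpoint fibL (a b : R) (n : nat) : R :=
  match n with
  | O => a
  | S O => b
  | S ((S m) as p) => fibL a b p + fibL a b m
  end.

Definition Fib (n : nat) : R := fibL 0 1 n.
Definition Luc (n : nat) : R := fibL 2 1 n.

Definition alpha : R := (1 + sqrt 5) / 2.
Definition beta  : R := (1 - sqrt 5) / 2.

Definition zeta (s : nat) : R := Series (fun k => / (INR (S k)) ^ s).

Definition Li (s : nat) (x : R) : R := Series (fun k => x ^ (S k) / (INR (S k)) ^ s).

(* Main.v *)
(** For [0 < x <= 1] put
      [G x = sum_{k>=1} (-1)^(k-1) zeta(2k) x^(2k) / (k (2k+n))].
    By Binet's formulas the two series are [G (alpha z) -/+ G (- beta z)], and their
    convergence forces [alpha z <= 1]; so a closed form for [G] is enough.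
    The derivative of [x^n G x] is [x^(n-1) ln (sinh (PI x) / (PI x))], by expanding the logarithm
    of Euler's product [sinh (PI x) = PI x prod (1 + x^2/m^2)]. Writing
    [ln (sinh y) = y - ln 2 + ln (1 - exp (-2y))] and using [Li_1 y = - ln (1 - y)],
    [d/dx Li_(s+1) (exp (-2 PI x)) = -2 PI Li_s (exp (-2 PI x))], the polylogarithm expression
    has the same derivative; both sides vanish at [0+], and Abel's theorem settles [x = 1].
    Euler's product comes from the integrals [int_0^(PI/2) cosh (2xt) cos^n t dt], whose two-step
    recurrence produces the factors [1 + x^2/m^2]. *)

Require Import Defs.
From Stdlib Require Import Reals Lra Lia ssreflect.
From Coquelicot Require Import Coquelicot.
Open Scope R_scope.

(** * Euler's product for sinh *)

(** At [x = 0] these are Wallis' integrals. The factor [2 * x] is chosen so that the recurrence,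
    taken at [n + 2 = 2 m], yields exactly [1 + x ^ 2 / m ^ 2]. *)
Definition wallis (x : R) (n : nat) : R :=
  RInt (fun t => cosh (2 * x * t) * cos t ^ n) 0 (PI / 2).

Lemma wallis_continuous (x : R) (n : nat) (t : R) :
  continuous (fun t => cosh (2 * x * t) * cos t ^ n) t.
Proof.
  apply: ex_derive_continuous. unfold cosh. auto_derive. repeat split.
Qed.

Lemma wallis_correct (x : R) (n : nat) :
  is_RInt (fun t => cosh (2 * x * t) * cos t ^ n) 0 (PI / 2) (wallis x n).
Proof.
  apply: RInt_correct. apply ex_RInt_continuous. intros. apply wallis_continuous.
Qed.

(** Two integrations by parts, carried out at once: the difference of the two integrands is the
    exact derivative of a function vanishing at both endpoints. *)
Lemma wallis_recurrence (x : R) (n : nat) :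
  (INR (S (S n)) ^ 2 + 4 * x ^ 2) * wallis x (S (S n))
  = INR (S (S n)) * INR (S n) * wallis x n.
Proof.
  (* The weights make the [sinh * cos ^ (n + 1) * sin] terms of the two derivatives cancel. The
     value at [PI / 2] vanishes because of [cos], the one at [0] because of [sin] and [sinh]. *)
  set (F t := INR (S (S n)) * (cosh (2 * x * t) * cos t ^ S n * sin t)
              + 2 * x * (sinh (2 * x * t) * cos t ^ S (S n))).
  assert (HF : is_RInt (fun t => (INR (S (S n)) ^ 2 + 4 * x ^ 2) *
      (cosh (2 * x * t) * cos t ^ S (S n))
      - INR (S (S n)) * INR (S n) * (cosh (2 * x * t) * cos t ^ n)) 0 (PI / 2)
      (minus (F (PI / 2)) (F 0))).
  { apply: is_RInt_derive.
    - intros t _. unfold F, cosh, sinh. auto_derive. trivial.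
      assert (Hs : sin t * sin t = 1 - cos t * cos t)
        by (pose proof (sin2_cos2 t) as H; unfold Rsqr in H; lra).
      match goal with |- ?a = ?b => change (@eq R a b) end.
      change (match n with 0%nat => 1 | S _ => INR n + 1 end) with (INR (S n)).
      set (e1 := exp (2 * x * t)). set (e2 := exp (- (2 * x * t))).
      rewrite -!(tech_pow_Rmult (cos t)). set (c := cos t) in *. set (s := sin t) in *.
      rewrite !S_INR.
      transitivity ((INR n + 1 + 1) * (- (INR n + 1) * (e1 + e2) / 2 * c ^ n * (s * s)
         + (e1 + e2) / 2 * c ^ n * c * c) + 4 * x ^ 2 * ((e1 + e2) / 2 * c ^ n * c * c)).
      + field.
      + rewrite Hs. match goal with |- ?a = ?b => change (@eq R a b) end. field.
    - intros t _. apply: ex_derive_continuous. unfold cosh. auto_derive. repeat split. }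
  assert (H0 : minus (F (PI / 2)) (F 0) = 0).
  { unfold F, minus, plus, opp; simpl. rewrite cos_PI2 sin_0 !Rmult_0_r sinh_0. ring. }
  rewrite H0 in HF.
  assert (H1 := is_RInt_minus _ _ _ _ _ _
    (is_RInt_scal _ _ _ (INR (S (S n)) ^ 2 + 4 * x ^ 2) _ (wallis_correct x (S (S n))))
    (is_RInt_scal _ _ _ (INR (S (S n)) * INR (S n)) _ (wallis_correct x n))).
  apply Rminus_diag_uniq.
  rewrite -(is_RInt_unique _ _ _ _ HF). symmetry.
  apply is_RInt_unique, H1.
Qed.

Lemma cos_pow_nonneg (n : nat) (t : R) : 0 <= t <= PI / 2 -> 0 <= cos t ^ n.
Proof. intros. apply pow_le, cos_ge_0; pose proof PI_RGT_0; lra. Qed.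

Lemma wallis_zero_pos (n : nat) : 0 < wallis 0 n.
Proof.
  pose proof PI_RGT_0.
  apply RInt_gt_0. lra.
  - intros t Ht. rewrite Rmult_0_r Rmult_0_l cosh_0 Rmult_1_l. apply pow_lt, cos_gt_0; lra.
  - intros t _. apply wallis_continuous.
Qed.

Lemma one_le_cosh (y : R) : 1 <= cosh y.
Proof.
  unfold cosh. rewrite exp_Ropp. pose proof (exp_pos y) as H.
  assert (0 <= (exp y - 1) ^ 2 / (2 * exp y)).
  { apply Rmult_le_pos. apply pow2_ge_0. left; apply Rinv_0_lt_compat; lra. }
  replace ((exp y + / exp y) / 2) with (1 + (exp y - 1) ^ 2 / (2 * exp y)) by (field; lra).
  lra.
Qed.

(** The difference vanishes at [0] and has derivative [v * sinh v >= 0]. *)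
Lemma sinh_le_mul_cosh (v : R) : 0 <= v -> sinh v <= v * cosh v.
Proof.
  intros Hv. unfold sinh, cosh.
  destruct (MVT_gen (fun v => v * ((exp v + exp (- v)) / 2) - (exp v - exp (- v)) / 2) 0 v
    (fun v => v * ((exp v - exp (- v)) / 2))) as (c & Hc & E).
  - intros. auto_derive. trivial. field.
  - intros. apply derivable_continuous_pt, ex_derive_Reals_0. auto_derive. trivial.
  - rewrite Rmin_left in Hc; auto. rewrite Rmax_right in Hc; auto.
    rewrite !Ropp_0 !exp_0 in E.
    assert (exp (- c) <= exp c) by (destruct (Req_dec c 0) as [->|];
      [rewrite Ropp_0; lra | left; apply exp_increasing; lra]).
    assert (0 <= c * ((exp c - exp (- c)) / 2) * (v - 0)) by (apply Rmult_le_pos; [apply Rmult_le_pos|]; lra).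
    lra.
Qed.

(** The difference vanishes at [0] and has derivative [v * sin v], nonnegative on this interval. *)
Lemma mul_cos_le_sin (v : R) : 0 <= v <= PI / 2 -> v * cos v <= sin v.
Proof.
  intros Hv. pose proof PI_RGT_0.
  destruct (MVT_gen (fun v => sin v - v * cos v) 0 v (fun v => v * sin v)) as (c & Hc & E).
  - intros. auto_derive. trivial. field.
  - intros. apply derivable_continuous_pt, ex_derive_Reals_0. auto_derive. trivial.
  - rewrite Rmin_left in Hc; try lra. rewrite Rmax_right in Hc; try lra.
    rewrite sin_0 in E.
    assert (0 <= sin c) by (apply sin_ge_0; lra).
    assert (0 <= c * sin c * (v - 0)) by (apply Rmult_le_pos; [apply Rmult_le_pos|]; lra).
    lra.
Qed.

(** Here [cosh (2 v) - 1 = 2 sinh v ^ 2 <= 2 v ^ 2 cosh v ^ 2], and [cosh v ^ 2 = (1 + cosh (2 v)) /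
    2 <= cosh (2 v)]. Keeping [cosh (2 v)] on the right lets the bound be integrated back into
    [wallis]. *)
Lemma cosh_sub_one_le (v : R) : 0 <= v -> cosh (2 * v) - 1 <= 2 * v ^ 2 * cosh (2 * v).
Proof.
  intros Hv. pose proof (sinh_le_mul_cosh v Hv) as H. pose proof (one_le_cosh (2 * v)).
  assert (E1 : cosh (2 * v) = 1 + 2 * sinh v ^ 2).
  { unfold cosh, sinh. replace (2 * v) with (v + v) by ring.
    rewrite Ropp_plus_distr !exp_plus exp_Ropp. field. apply Rgt_not_eq, exp_pos. }
  assert (E2 : cosh v ^ 2 = (1 + cosh (2 * v)) / 2).
  { unfold cosh. replace (2 * v) with (v + v) by ring.
    rewrite Ropp_plus_distr !exp_plus exp_Ropp. field. apply Rgt_not_eq, exp_pos. }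
  assert (Hs : 0 <= sinh v).
  { destruct (Req_dec v 0) as [->|]; [rewrite sinh_0; lra|].
    rewrite -sinh_0. left; apply sinh_lt; lra. }
  assert (sinh v ^ 2 <= (v * cosh v) ^ 2) by (apply pow_incr; lra).
  rewrite Rpow_mult_distr E2 in H1.
  assert (0 <= v ^ 2) by apply pow2_ge_0.
  nra.
Qed.

Lemma wallis_zero_le (x : R) (n : nat) : wallis 0 n <= wallis x n.
Proof.
  pose proof PI_RGT_0.
  apply RInt_le. lra. eexists; apply wallis_correct. eexists; apply wallis_correct.
  intros t Ht. apply Rmult_le_compat_r. apply cos_pow_nonneg; lra.
  rewrite Rmult_0_r Rmult_0_l cosh_0. apply one_le_cosh.
Qed.

(* [t cos t <= sin t] turns the factor [t ^ 2 * cos t ^ 2] coming from [cosh - 1] into [1 - cos t ^ 2]. *)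
Lemma wallis_sub_le (x : R) (n : nat) : 0 <= x ->
  wallis x (S (S n)) - wallis 0 (S (S n)) <= 2 * x ^ 2 * (wallis x n - wallis x (S (S n))).
Proof.
  intros Hx. pose proof PI_RGT_0.
  assert (H1 := is_RInt_minus _ _ _ _ _ _ (wallis_correct x (S (S n))) (wallis_correct 0 (S (S n)))).
  assert (H2 := is_RInt_scal _ _ _ (2 * x ^ 2) _ (is_RInt_minus _ _ _ _ _ _ (wallis_correct x n) (wallis_correct x (S (S n))))).
  refine (is_RInt_le _ _ _ _ _ _ _ H1 H2 _). lra.
  intros t Ht. unfold minus, plus, opp, scal; simpl; unfold mult; simpl.
  rewrite Rmult_0_r Rmult_0_l cosh_0.
  assert (Hc := cos_pow_nonneg n t ltac:(lra)).
  assert (H3 := cosh_sub_one_le (x * t) ltac:(apply Rmult_le_pos; lra)).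
  rewrite -Rmult_assoc in H3.
  assert (H4 := mul_cos_le_sin t ltac:(lra)).
  assert (H5 : 0 <= cos t) by (apply cos_ge_0; lra).
  assert (H6 : (t * cos t) ^ 2 <= sin t ^ 2) by (apply pow_incr; split; [apply Rmult_le_pos|]; lra).
  assert (H7 : sin t ^ 2 = 1 - cos t ^ 2) by (pose proof (sin2_cos2 t); unfold Rsqr in *; lra).
  pose proof (one_le_cosh (2 * x * t)) as H8.
  set (C := cosh (2 * x * t)) in *. set (c := cos t) in *.
  apply Rle_trans with (cos t ^ n * (c ^ 2 * (C - 1))). right; unfold c; ring.
  apply Rle_trans with (cos t ^ n * (2 * x ^ 2 * C * (1 - c ^ 2))). 2: right; unfold c; ring.
  apply Rmult_le_compat_l; auto.
  apply Rle_trans with (c ^ 2 * (2 * (x * t) ^ 2 * C)).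
  apply Rmult_le_compat_l; auto. apply pow2_ge_0.
  rewrite -H7. replace (c ^ 2 * (2 * (x * t) ^ 2 * C)) with (2 * x ^ 2 * C * (t * c) ^ 2) by ring.
  apply Rmult_le_compat_l; auto. apply Rmult_le_pos; [|lra].
  pose proof (pow2_ge_0 x); lra.
Qed.

(** By the recurrence, [wallis x n] exceeds [wallis x (n + 2)] by a relative error of order [1 / n];
    [wallis_sub_le] transfers this to the gap between [x] and [0]. With [wallis_zero_le] it makes
    the ratio tend to 1. *)
Lemma wallis_ratio_ge (x : R) (n : nat) : 0 <= x ->
  wallis 0 (S (S n)) / wallis x (S (S n)) >= 1 - 2 * x ^ 2 * (1 + 4 * x ^ 2) * / INR (S n).
Proof.
  intros Hx.
  assert (P0 := wallis_zero_pos (S (S n))). assert (L := wallis_zero_le x (S (S n))).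
  assert (S1 := wallis_sub_le x n Hx). assert (R1 := wallis_recurrence x n).
  set (A := wallis 0 (S (S n))) in *. set (B := wallis x (S (S n))) in *. set (D := wallis x n) in *.
  assert (0 <= INR n) by apply pos_INR. rewrite !S_INR in R1 |- *. set (m := INR n + 1) in *.
  assert (1 <= m) by (unfold m; lra).
  assert (ED : D = ((m + 1) ^ 2 + 4 * x ^ 2) * B / ((m + 1) * m)).
  { apply Rmult_eq_reg_l with ((m + 1) * m). rewrite -R1. field; lra. nra. }
  assert (HDB : D - B <= (1 + 4 * x ^ 2) / m * B).
  { rewrite ED. assert (0 <= 4 * x ^ 2 * m * B).
    { apply Rmult_le_pos; [|lra]. apply Rmult_le_pos; [|lra]. pose proof (pow2_ge_0 x); lra. }
    assert (0 <= (4 * x ^ 2 * m ) * B / ((m + 1) * m)).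
    { apply Rmult_le_pos. lra. left. apply Rinv_0_lt_compat. nra. }
    replace ((1 + 4 * x ^ 2) / m * B) with
      (((m + 1) ^ 2 + 4 * x ^ 2) * B / ((m + 1) * m) - B + (4 * x ^ 2 * m) * B / ((m + 1) * m)).
    lra. field. lra. }
  assert (H2 : 2 * x ^ 2 * (D - B) <= 2 * x ^ 2 * ((1 + 4 * x ^ 2) / m * B)).
  { apply Rmult_le_compat_l; auto. pose proof (pow2_ge_0 x); lra. }
  apply Rle_ge. apply Rmult_le_reg_r with B. lra.
  replace (A / B * B) with A by (field; lra).
  replace ((1 - 2 * x ^ 2 * (1 + 4 * x ^ 2) * / m) * B) with (B - 2 * x ^ 2 * ((1 + 4 * x ^ 2) / m * B)) by (field; lra).
  lra.
Qed.

Lemma wallis_0_ratio (x : R) : 0 < x -> wallis x 0 / wallis 0 0 = sinh (PI * x) / (PI * x).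
Proof.
  intros Hx. pose proof PI_RGT_0.
  assert (H0 : wallis 0 0 = PI / 2).
  { unfold wallis. rewrite (RInt_ext _ (fun _ => 1)).
    rewrite RInt_const /scal /= /mult /=. lra.
    intros. rewrite Rmult_0_r Rmult_0_l cosh_0. simpl; ring. }
  assert (H1 : wallis x 0 = sinh (PI * x) / (2 * x)).
  { apply is_RInt_unique.
    replace (sinh (PI * x) / (2 * x)) with
      (minus ((fun t => sinh (2 * x * t) / (2 * x)) (PI / 2)) ((fun t => sinh (2 * x * t) / (2 * x)) 0)).
    apply (is_RInt_derive (fun t => sinh (2 * x * t) / (2 * x))).
    - intros t _. unfold sinh, cosh. auto_derive. trivial. field. lra.
    - intros t _. apply wallis_continuous.
    - unfold minus, plus, opp; simpl. rewrite Rmult_0_r sinh_0.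
      replace (2 * x * (PI / 2)) with (PI * x) by field. field. lra. }
  rewrite H0 H1. field. lra.
Qed.

(** A telescoping sum: by the recurrence for [x] and for [0], each factor [1 + x ^ 2 / m ^ 2] is a
    quotient of consecutive ratios [wallis 0 (2 m) / wallis x (2 m)]. The initial ratio gives the
    [sinh] term. *)
Lemma sum_ln_eq_wallis (x : R) (N : nat) : 0 < x ->
  sum_n (fun m => ln (1 + x ^ 2 / INR (S m) ^ 2)) N
  = ln (sinh (PI * x) / (PI * x))
    + ln (wallis 0 (2 * S N) / wallis x (2 * S N)).
Proof.
  intros Hx.
  assert (P : forall y n, 0 < wallis y n).
  { intros. eapply Rlt_le_trans. apply wallis_zero_pos. apply wallis_zero_le. }
  assert (step : forall N, ln (1 + x ^ 2 / INR (S N) ^ 2)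
     + ln (wallis 0 (2 * N) / wallis x (2 * N)) = ln (wallis 0 (2 * S N) / wallis x (2 * S N))).
  { intros M. rewrite -ln_mult.
    - f_equal. replace (2 * S M)%nat with (S (S (2 * M))) by lia.
      assert (R0 := wallis_recurrence 0 (2 * M)). assert (R1 := wallis_recurrence x (2 * M)).
      assert (P1 := P 0 (S (S (2 * M)))). assert (P2 := P x (S (S (2 * M)))).
      assert (P3 := P 0 (2 * M)%nat). assert (P4 := P x (2 * M)%nat).
      assert (HS : INR (S (S (2 * M))) = 2 * INR (S M)).
      { rewrite !S_INR mult_INR. simpl. ring. }
      rewrite !HS in R0 R1.
      assert (Q1 : 0 < INR (S M)) by apply lt_0_INR, Nat.lt_0_succ.
      assert (Q2 : 0 < INR (S (2 * M))) by apply lt_0_INR, Nat.lt_0_succ.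
      set (a := wallis 0 (2 * M)) in *. set (b := wallis x (2 * M)) in *.
      set (a' := wallis 0 _) in *. set (b' := wallis x _) in *.
      set (p := INR (S M)) in *. set (q := INR (S (2 * M))) in *.
      assert (Ea : a = (2 * p) * a' / q).
      { apply Rmult_eq_reg_l with (2 * p * q). rewrite -R0. field; lra. nra. }
      assert (Eb : b = ((2 * p) ^ 2 + 4 * x ^ 2) * b' / (2 * p * q)).
      { apply Rmult_eq_reg_l with (2 * p * q). rewrite -R1. field; lra. nra. }
      rewrite Ea Eb. field. repeat split; try lra. nra.
    - assert (0 <= x ^ 2 / INR (S M) ^ 2); [|lra].
      apply Rmult_le_pos. apply pow2_ge_0. left; apply Rinv_0_lt_compat, pow_lt, lt_0_INR; lia.
    - apply Rdiv_lt_0_compat; auto. }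
  induction N as [|N IH].
  - rewrite sum_O -step -(wallis_0_ratio x Hx).
    replace (2 * 0)%nat with 0%nat by lia.
    assert (ln (wallis x 0 / wallis 0 0) + ln (wallis 0 0 / wallis x 0) = 0); [|lra].
    rewrite -ln_mult; try (apply Rdiv_lt_0_compat; auto).
    transitivity (ln 1). 2: apply ln_1. f_equal. field. split; apply Rgt_not_eq, P.
  - rewrite sum_Sn IH. unfold plus; simpl plus. rewrite -(step (S N)). simpl; ring.
Qed.

(** Euler's product in logarithmic form: the remaining ratio of integrals is squeezed between
    [1 - C / (N + 1)] and [1]. *)
Lemma is_series_ln_sinh (x : R) : 0 < x ->
  is_series (fun m => ln (1 + x ^ 2 / INR (S m) ^ 2)) (ln (sinh (PI * x) / (PI * x))).
Proof.
  intros Hx.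
  assert (P : forall y n, 0 < wallis y n).
  { intros. eapply Rlt_le_trans. apply wallis_zero_pos. apply wallis_zero_le. }
  unfold is_series.
  apply (is_lim_seq_ext (fun N => ln (sinh (PI * x) / (PI * x))
    + ln (wallis 0 (2 * S N) / wallis x (2 * S N))) _ (ln (sinh (PI * x) / (PI * x)))).
  { intros. symmetry. apply sum_ln_eq_wallis; auto. }
  replace (Finite (ln (sinh (PI * x) / (PI * x)))) with
    (Finite (ln (sinh (PI * x) / (PI * x)) + ln 1)) by (rewrite ln_1 Rplus_0_r; auto).
  apply is_lim_seq_plus'. apply is_lim_seq_const.
  apply (is_lim_seq_continuous ln). apply derivable_continuous_pt, ex_derive_Reals_0. eexists. apply is_derive_ln. lra.
  apply (is_lim_seq_le_le (fun N => 1 - 2 * x ^ 2 * (1 + 4 * x ^ 2) * / INR (S N)) _ (fun _ => 1)).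
  - intros N. replace (2 * S N)%nat with (S (S (2 * N))) by lia.
    assert (H := wallis_ratio_ge x (2 * N) ltac:(lra)). split.
    + apply Rge_le in H. apply Rle_trans with (2 := H).
      apply Rplus_le_compat_l, Ropp_le_contravar, Rmult_le_compat_l.
      pose proof (pow2_ge_0 x). nra.
      apply Rinv_le_contravar. apply lt_0_INR; lia. apply le_INR; lia.
    + apply Rmult_le_reg_r with (wallis x (S (S (2 * N)))). auto.
      unfold Rdiv. rewrite Rmult_assoc Rinv_l; [|apply Rgt_not_eq, P].
      pose proof (wallis_zero_le x (S (S (2 * N)))). lra.
  - replace (Finite 1) with (Finite (1 - 2 * x ^ 2 * (1 + 4 * x ^ 2) * 0)) by (f_equal; ring).
    apply is_lim_seq_minus'. apply is_lim_seq_const. apply is_lim_seq_mult'. apply is_lim_seq_const.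
    apply (is_lim_seq_incr_1 (fun n => / INR n)).
    apply (is_lim_seq_inv INR p_infty). apply is_lim_seq_INR. easy.
  - apply is_lim_seq_const.
Qed.

(** * Polylogarithms and the power series of ln (sinh (PI x) / (PI x)) *)

Lemma CV_radius_ge_1 (a : nat -> R) (M : R) :
  (forall k, Rabs (a k) <= M) -> Rbar_le 1 (CV_radius a).
Proof.
  intros Ha. apply (proj1 (CV_radius_bounded a)). exists M. intros k.
  rewrite pow1 Rmult_1_r. apply Ha.
Qed.

Lemma inside_CV_radius (a : nat -> R) (M y : R) :
  (forall k, Rabs (a k) <= M) -> Rabs y < 1 -> Rbar_lt (Rabs y) (CV_radius a).
Proof. intros Ha Hy. apply Rbar_lt_le_trans with 1. exact Hy. apply (CV_radius_ge_1 a M Ha). Qed.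

(** Serves both as the general term of [zeta s] and as the coefficients of the power series of
    [Li s y / y]. *)
Definition inv_pow (s k : nat) : R := / INR (S k) ^ s.

Lemma inv_pow_pos (s k : nat) : 0 < inv_pow s k.
Proof. apply Rinv_0_lt_compat, pow_lt, lt_0_INR, Nat.lt_0_succ. Qed.

Lemma INR_S_ge_1 (k : nat) : 1 <= INR (S k).
Proof. rewrite S_INR. pose proof (pos_INR k). lra. Qed.

Lemma inv_pow_anti (s t k : nat) : (s <= t)%nat -> inv_pow t k <= inv_pow s k.
Proof.
  intros H. apply Rinv_le_contravar. apply pow_lt, lt_0_INR, Nat.lt_0_succ.
  apply Rle_pow; auto. apply INR_S_ge_1.
Qed.

Lemma inv_pow_bounded (s k : nat) : Rabs (inv_pow s k) <= 1.
Proof.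
  rewrite Rabs_pos_eq. 2: left; apply inv_pow_pos.
  apply Rle_trans with (1 := inv_pow_anti 0 s k (Nat.le_0_l s)).
  unfold inv_pow. rewrite pow_O. lra.
Qed.

Lemma Li_PSeries (s : nat) (y : R) : Li s y = y * PSeries (inv_pow s) y.
Proof.
  unfold Li, PSeries. rewrite -Series_scal_l. apply Series_ext. intros k.
  unfold inv_pow, Rdiv. simpl. ring.
Qed.

Lemma is_series_Li (s : nat) (y : R) : Rabs y < 1 ->
  is_series (fun k => y ^ S k / INR (S k) ^ s) (Li s y).
Proof.
  intros Hy. apply Series_correct.
  apply (ex_series_ext (fun k => y * (inv_pow s k * y ^ k))).
  { intros. unfold inv_pow. simpl. unfold Rdiv. ring. }
  apply: ex_series_scal_l.
  apply ex_pseries_R, CV_radius_inside, (inside_CV_radius _ 1 _ (inv_pow_bounded s)); auto.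
Qed.

(** Termwise differentiation. The derivative is [Li s y / y], written as a power series so that
    [y = 0] is covered. *)
Lemma is_derive_Li (s : nat) (y : R) : Rabs y < 1 ->
  is_derive (Li (S s)) y (PSeries (inv_pow s) y).
Proof.
  intros Hy.
  apply (is_derive_ext (PSeries (PS_incr_1 (inv_pow (S s))))).
  { intros t. rewrite PSeries_incr_1 Li_PSeries. reflexivity. }
  rewrite -(PSeries_ext (PS_derive (PS_incr_1 (inv_pow (S s))))).
  - apply is_derive_PSeries, (inside_CV_radius _ 1); auto.
    intros [|k]; simpl. rewrite Rabs_R0; lra. apply inv_pow_bounded.
  - intros k. unfold PS_derive, PS_incr_1, inv_pow.
    assert (INR (S k) <> 0) by (apply not_0_INR; lia).
    rewrite -tech_pow_Rmult. field. split; auto. apply pow_nonzero; auto.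
Qed.

(** The derivative of [Li 1] is the geometric series, so [Li 1 t + ln (1 - t)] is constant, and it
    vanishes at [0]. *)
Lemma Li_1 (y : R) : Rabs y < 1 -> Li 1 y = - ln (1 - y).
Proof.
  intros Hy.
  assert (Hb : forall t, Rmin 0 y <= t <= Rmax 0 y -> Rabs t < 1).
  { intros t. unfold Rmin, Rmax. destruct (Rle_dec 0 y); split_Rabs; lra. }
  assert (HD : forall t, Rmin 0 y <= t <= Rmax 0 y ->
     is_derive (fun t => Li 1 t + ln (1 - t)) t 0).
  { intros t Ht. apply Hb in Ht.
    assert (1 - t <> 0) by (split_Rabs; lra).
    replace 0 with (PSeries (inv_pow 0) t + - 1 / (1 - t)).
    - apply: (is_derive_plus (Li 1)). apply is_derive_Li; auto.
      auto_derive. split_Rabs; lra. field; auto.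
    - unfold PSeries. rewrite (Series_ext _ (fun k => t ^ k)).
      rewrite Series_geom; auto. field; auto.
      intros. unfold inv_pow. simpl. field. }
  destruct (MVT_gen (fun t => Li 1 t + ln (1 - t)) 0 y (fun _ => 0)) as (c & _ & E).
  - intros t Ht. apply HD. lra.
  - intros t Ht. apply derivable_continuous_pt, ex_derive_Reals_0. eexists; apply HD; auto.
  - rewrite (Li_PSeries 1 0) Rmult_0_l Rminus_0_r ln_1 in E. rewrite Rmult_0_l in E. lra.
Qed.

Lemma is_series_ln_1p (y : R) : Rabs y < 1 ->
  is_series (fun k => (-1) ^ k * y ^ S k / INR (S k)) (ln (1 + y)).
Proof.
  intros Hy.
  replace (ln (1 + y)) with (- Li 1 (- y)).
  2: rewrite Li_1 ?Rabs_Ropp //; rewrite Ropp_involutive; f_equal; ring.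
  apply (is_series_ext (fun k => - ((- y) ^ S k / INR (S k) ^ 1))).
  { intros k. replace (- y) with (-1 * y) by ring. rewrite Rpow_mult_distr pow_1. simpl ((-1) ^ S k).
    match goal with |- ?a = ?b => change (@eq R a b) end. field. apply not_0_INR; lia. }
  apply: is_series_opp. apply is_series_Li. rewrite Rabs_Ropp //.
Qed.

(** Comparison with a telescoping series: [1 / (k+1) ^ 2 <= 2 / ((k+1) (k+2))]. *)
Lemma ex_series_inv_pow (s : nat) : (2 <= s)%nat -> ex_series (inv_pow s).
Proof.
  intros Hs.
  apply (@ex_series_le R_AbsRing R_CompleteNormedModule (inv_pow s) (fun k => 2 * (/ INR (S k) - / INR (S (S k))))).
  - intros k. change (norm (inv_pow s k)) with (Rabs (inv_pow s k)).
    rewrite Rabs_pos_eq. 2: left; apply inv_pow_pos.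
    apply Rle_trans with (1 := inv_pow_anti 2 s k Hs).
    unfold inv_pow. rewrite !S_INR. pose proof (pos_INR k). set (r := INR k) in *.
    apply Rmult_le_reg_r with ((r + 1) ^ 2 * (r + 2)). nra.
    replace (/ (r + 1) ^ 2 * ((r + 1) ^ 2 * (r + 2))) with (r + 2) by (field; lra).
    replace (2 * (/ (r + 1) - / (r + 1 + 1)) * ((r + 1) ^ 2 * (r + 2))) with (2 * (r + 1)) by (field; lra).
    lra.
  - apply: ex_series_scal_l.
    exists 1. unfold is_series.
    apply (is_lim_seq_ext (fun k => 1 - / INR (S (S k))) _ 1).
    + intros k. induction k. rewrite sum_O. simpl; field.
      rewrite sum_Sn -IHk.
      change (1 - / INR (S (S (S k))) = 1 - / INR (S (S k)) + (/ INR (S (S k)) - / INR (S (S (S k))))). ring.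
    + replace (Finite 1) with (Finite (1 - 0)) by (f_equal; ring).
      apply is_lim_seq_minus'. apply is_lim_seq_const.
      apply (is_lim_seq_incr_1 (fun n => / INR (S n))), (is_lim_seq_incr_1 (fun n => / INR n)).
      apply (is_lim_seq_inv INR p_infty). apply is_lim_seq_INR. easy.
Qed.

(** The tail bound is uniform in [s]; this is what permits the interchange of sums in
    [log_series_eq]. *)
Lemma zeta_sub_partial_bounds (s M : nat) : (2 <= s)%nat ->
  0 <= zeta s - sum_n (inv_pow s) M <= zeta 2 - sum_n (inv_pow 2) M.
Proof.
  intros Hs.
  assert (T : forall t, (2 <= t)%nat ->
    zeta t - sum_n (inv_pow t) M = Series (fun k => inv_pow t (S M + k))).
  { intros t Ht. change (zeta t) with (Series (inv_pow t)).
    rewrite (Series_incr_n (inv_pow t) (S M)); [|lia|apply ex_series_inv_pow; auto].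
    simpl pred. rewrite sum_n_Reals. ring. }
  assert (X : forall t, (2 <= t)%nat -> ex_series (fun k => inv_pow t (S M + k))).
  { intros t Ht. apply (ex_series_incr_n (inv_pow t) (S M)). apply ex_series_inv_pow; auto. }
  rewrite !T; auto. split.
  - apply Rle_trans with (Series (fun _ => 0)).
    rewrite -PSeries_1 PSeries_const_0; lra.
    apply Series_le; auto. intros; split. lra. left; apply inv_pow_pos.
  - apply Series_le; auto. intros; split. left; apply inv_pow_pos. apply inv_pow_anti; auto.
Qed.

Lemma zeta_bounds (s : nat) : (2 <= s)%nat -> 1 <= zeta s <= zeta 2.
Proof.
  intros Hs. destruct (zeta_sub_partial_bounds s 0 Hs) as [H1 H2]. rewrite !sum_O in H1 H2.
  unfold inv_pow in *. rewrite !pow1 in H1 H2. lra.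
Qed.

Definition log_coef (k : nat) : R := (-1) ^ k * zeta (2 * S k) / INR (S k).

Lemma log_coef_bounded (k : nat) : Rabs (log_coef k) <= zeta 2.
Proof.
  unfold log_coef, Rdiv. rewrite !Rabs_mult pow_1_abs Rmult_1_l.
  destruct (zeta_bounds (2 * S k) ltac:(lia)) as [H1 H2].
  rewrite Rabs_pos_eq; [|lra]. pose proof (INR_S_ge_1 k).
  rewrite Rabs_pos_eq. 2: left; apply Rinv_0_lt_compat; lra.
  apply Rle_trans with (zeta (2 * S k) * 1); [|lra].
  apply Rmult_le_compat_l. lra. rewrite -Rinv_1. apply Rinv_le_contravar; lra.
Qed.

(** Only finitely many logarithms are expanded and added here, so no interchange of infinite sums is
    involved yet. *)
Lemma is_series_sum_ln (x : R) (M : nat) : 0 < x < 1 ->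
  is_series (fun k => (-1) ^ k * (x ^ 2) ^ S k / INR (S k) * sum_n (inv_pow (2 * S k)) M)
    (sum_n (fun m => ln (1 + x ^ 2 / INR (S m) ^ 2)) M).
Proof.
  intros Hx.
  assert (H : forall m, is_series (fun k => (-1) ^ k * (x ^ 2) ^ S k / INR (S k) * inv_pow (2 * S k) m)
    (ln (1 + x ^ 2 / INR (S m) ^ 2))).
  { intros m. pose proof (INR_S_ge_1 m) as Hm.
    apply (is_series_ext (fun k => (-1) ^ k * (x ^ 2 / INR (S m) ^ 2) ^ S k / INR (S k))).
    - intros k. unfold inv_pow, Rdiv. rewrite Rpow_mult_distr pow_mult pow_inv.
      match goal with |- ?a = ?b => change (@eq R a b) end. ring.
    - apply is_series_ln_1p.
      assert (1 <= INR (S m) ^ 2) by nra.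
      assert (0 < x ^ 2 < 1) by nra.
      rewrite Rabs_pos_eq.
      apply Rmult_lt_reg_r with (INR (S m) ^ 2). lra. unfold Rdiv. rewrite Rmult_assoc Rinv_l; lra.
      apply Rmult_le_pos. lra. left; apply Rinv_0_lt_compat; lra. }
  induction M as [|M IH].
  - rewrite sum_O. eapply is_series_ext. 2: apply (H 0%nat). intros k. simpl. rewrite sum_O. reflexivity.
  - rewrite sum_Sn.
    eapply is_series_ext. 2: apply (is_series_plus _ _ _ _ IH (H (S M))).
    intros k. rewrite sum_Sn.
    repeat match goal with |- context [@plus ?G ?a ?b] => change (@plus G a b) with (Rplus a b) end.
    match goal with |- ?a = ?b => change (@eq R a b) end. ring.
Qed.

(** The partial sums of the logarithms converge to the logarithm of Euler's product; it remains to
    see that they also converge to the power series, which is an interchange of two infinite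
    sums. *)
Lemma log_series_eq (x : R) : 0 < x < 1 ->
  x ^ 2 * PSeries log_coef (x ^ 2) = ln (sinh (PI * x) / (PI * x)).
Proof.
  intros Hx.
  assert (Hq : 0 < x ^ 2 < 1) by nra. set (q := x ^ 2) in *.
  assert (Hq1 : Rabs q < 1) by (rewrite Rabs_pos_eq; lra).
  assert (HS : is_series (fun k => q * (log_coef k * q ^ k)) (q * PSeries log_coef q)).
  { apply: is_series_scal_l. apply Series_correct.
    apply ex_pseries_R, CV_radius_inside, (inside_CV_radius _ _ _ log_coef_bounded); auto. }
  assert (HL : is_lim_seq (sum_n (fun m => ln (1 + q / INR (S m) ^ 2))) (q * PSeries log_coef q)).
  2: { assert (H2 := is_series_ln_sinh x (proj1 Hx)).
       apply is_lim_seq_unique in HL. apply (is_lim_seq_unique (sum_n _) (Finite _)) in H2.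
       rewrite HL in H2. injection H2. auto. }
  (* Termwise, the error is at most the tail of [zeta 2] times [q ^ (k+1)]; summing over [k] leaves
     the tail times [q / (1 - q)]. *)
  assert (HB : forall M, Rabs (sum_n (fun m => ln (1 + q / INR (S m) ^ 2)) M - q * PSeries log_coef q)
     <= (zeta 2 - sum_n (inv_pow 2) M) * (q / (1 - q))).
  { intros M.
    assert (H3 := is_series_minus _ _ _ _ (is_series_sum_ln x M Hx) HS).
    assert (HG : is_series (fun k => (zeta 2 - sum_n (inv_pow 2) M) * (q * q ^ k))
       ((zeta 2 - sum_n (inv_pow 2) M) * (q / (1 - q)))).
    { apply: is_series_scal_l. apply: is_series_scal_l. apply is_series_geom; auto. }
    match type of H3 with is_series ?a ?b => set (u := a) in H3; set (l := b) in H3 end.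
    assert (Hu : forall k, Rabs (u k) <= (zeta 2 - sum_n (inv_pow 2) M) * (q * q ^ k)).
    { intros k. unfold u, log_coef.
      repeat match goal with
             | |- context [@plus ?G ?a ?b] => change (@plus G a b) with (Rplus a b)
             | |- context [@opp ?G ?a] => change (@opp G a) with (Ropp a) end.
      destruct (zeta_sub_partial_bounds (2 * S k) M ltac:(lia)) as [B1 B2].
      set (Z := zeta (2 * S k)) in *. set (ZM := sum_n (inv_pow (2 * S k)) M) in *.
      match goal with |- Rabs ?e <= _ =>
        replace e with ((-1) ^ k * (- (Z - ZM) * (q ^ S k * / INR (S k)))) end.
      2: { fold q. simpl (q ^ S k). field. apply not_0_INR; lia. }
      rewrite Rabs_mult pow_1_abs Rmult_1_l Rabs_mult Rabs_Ropp (Rabs_pos_eq (Z - ZM)); auto.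
      apply Rmult_le_compat; auto. apply Rabs_pos.
      pose proof (INR_S_ge_1 k).
      rewrite Rabs_pos_eq.
      2: apply Rmult_le_pos; [apply pow_le|left; apply Rinv_0_lt_compat]; lra.
      simpl (q ^ S k). rewrite -{2}(Rmult_1_r (q * q ^ k)).
      apply Rmult_le_compat_l. apply Rmult_le_pos. lra. apply pow_le; lra.
      rewrite -Rinv_1. apply Rinv_le_contravar; lra. }
    change (sum_n _ M - q * PSeries log_coef q) with l.
    rewrite -(is_series_unique _ _ H3) -(is_series_unique _ _ HG).
    assert (HA : ex_series (fun k => Rabs (u k))).
    { apply (fun H => @ex_series_le R_AbsRing R_CompleteNormedModule _ _ H (ex_intro _ _ HG)).
      intros k. change (norm (Rabs (u k))) with (Rabs (Rabs (u k))). rewrite Rabs_Rabsolu. apply Hu. }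
    apply Rle_trans with (1 := Series_Rabs _ HA).
    apply Series_le. intros; split; auto. apply Rabs_pos. eexists; apply HG. }
  assert (HZ : is_lim_seq (fun M => (zeta 2 - sum_n (inv_pow 2) M) * (q / (1 - q))) 0).
  { replace (Finite 0) with (Finite ((zeta 2 - zeta 2) * (q / (1 - q)))) by (f_equal; ring).
    apply is_lim_seq_mult'. 2: apply is_lim_seq_const.
    apply is_lim_seq_minus'. apply is_lim_seq_const.
    exact (Series_correct _ (ex_series_inv_pow 2 (le_n 2))). }
  set (v := sum_n _) in *.
  apply (is_lim_seq_ext (fun M => (v M - q * PSeries log_coef q) + q * PSeries log_coef q)).
  intros; ring.
  replace (Finite (q * PSeries log_coef q)) with (Finite (0 + q * PSeries log_coef q)) by (f_equal; ring).
  apply is_lim_seq_plus'. 2: apply is_lim_seq_const.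
  apply is_lim_seq_abs_0.
  apply (is_lim_seq_le_le (fun _ => 0) _ _ 0 (fun M => conj (Rabs_pos _) (HB M))); auto.
  apply is_lim_seq_const.
Qed.

(** * The closed form and its derivative *)

(** Convergence at 1 forces a radius of at least 1. A larger radius gives ordinary continuity, a
    radius equal to 1 is Abel's theorem. *)
Lemma PSeries_left_continuous_1 (a : nat -> R) : ex_series a ->
  filterlim (PSeries a) (at_left 1) (locally (PSeries a 1)).
Proof.
  intros Ha.
  assert (H1 : Rbar_le 1 (CV_radius a)).
  { apply Rbar_not_lt_le. intros H. apply (CV_disk_outside a 1).
    rewrite Rabs_R1 //.
    apply (is_lim_seq_ext a). intros; rewrite pow1; ring. apply ex_series_lim_0, Ha. }
  destruct (Rbar_le_lt_or_eq_dec _ _ H1) as [H|H].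
  - eapply filterlim_filter_le_1. apply filter_le_within.
    apply continuity_pt_filterlim, PSeries_continuity. rewrite Rabs_R1 //.
  - assert (E : real (CV_radius a) = 1) by (rewrite -H //).
    pose proof (Abel a) as B. rewrite E -H in B. apply B. exact Rlt_0_1. exact I.
    apply ex_pseries_R. apply (ex_series_ext a); auto. intros; rewrite pow1 Rmult_1_r //.
Qed.

Lemma filterlim_Rplus {F : (R -> Prop) -> Prop} {FF : Filter F} (f g : R -> R) (a b : R) :
  filterlim f F (locally a) -> filterlim g F (locally b) ->
  filterlim (fun x => f x + g x) F (locally (a + b)).
Proof. intros Hf Hg. apply: filterlim_comp_2 Hf Hg _. apply: (filterlim_plus a b). Qed.

Lemma filterlim_Rmult {F : (R -> Prop) -> Prop} {FF : Filter F} (f g : R -> R) (a b : R) :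
  filterlim f F (locally a) -> filterlim g F (locally b) ->
  filterlim (fun x => f x * g x) F (locally (a * b)).
Proof. intros Hf Hg. apply: filterlim_comp_2 Hf Hg _. apply: (filterlim_mult a b). Qed.

Lemma filterlim_at_right_continuous (f : R -> R) (a : R) :
  continuous f a -> filterlim f (at_right a) (locally (f a)).
Proof. intros H. eapply filterlim_filter_le_1. apply filter_le_within. exact H. Qed.

Lemma filterlim_at_left_continuous (f : R -> R) (a : R) :
  continuous f a -> filterlim f (at_left a) (locally (f a)).
Proof. intros H. eapply filterlim_filter_le_1. apply filter_le_within. exact H. Qed.

Definition exp_Li (s : nat) (x : R) : R := Li s (exp (- (2 * PI * x))).

Lemma exp_neg_bounds (x : R) : 0 < x -> 0 < exp (- (2 * PI * x)) < 1.
Proof.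
  intros Hx. split. apply exp_pos. rewrite -exp_0. apply exp_increasing.
  pose proof PI_RGT_0. nra.
Qed.

(** The exponential produced by the chain rule cancels the division by [y] in the derivative
    [Li s y / y]. *)
Lemma is_derive_exp_Li (s : nat) (x : R) : 0 < x ->
  is_derive (exp_Li (S s)) x (- (2 * PI) * exp_Li s x).
Proof.
  intros Hx. unfold exp_Li. rewrite Li_PSeries.
  pose proof (exp_neg_bounds x Hx) as He. set (e := exp (- (2 * PI * x))) in *.
  replace (- (2 * PI) * (e * PSeries (inv_pow s) e)) with
    (scal (- (2 * PI) * e) (PSeries (inv_pow s) e)) by (rewrite /scal /= /mult /=; ring).
  apply (is_derive_comp (Li (S s)) (fun x => exp (- (2 * PI * x)))).
  - apply is_derive_Li. rewrite Rabs_pos_eq; fold e; lra.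
  - unfold e. auto_derive. trivial. ring.
Qed.

(** As [x] decreases to [0] the exponential tends to 1 from the left, where Abel's theorem applies;
    order at least 2 makes the series converge at 1. *)
Lemma exp_Li_at_0 (s : nat) : filterlim (exp_Li (S (S s))) (at_right 0) (locally (zeta (S (S s)))).
Proof.
  apply (filterlim_comp _ _ _ (fun x => exp (- (2 * PI * x))) (Li (S (S s))) _ (at_left 1)).
  - intros P [d Hd].
    assert (Hc : continuous (fun x => exp (- (2 * PI * x))) 0).
    { apply: ex_derive_continuous. auto_derive. trivial. }
    destruct (Hc (ball 1 d)) as [d' Hd'].
    { rewrite Rmult_0_r Ropp_0 exp_0. apply locally_ball. }
    exists d'. intros y Hy Hy0. apply Hd. apply Hd'; auto. apply exp_neg_bounds; auto.
  - replace (zeta (S (S s))) with (1 * PSeries (inv_pow (S (S s))) 1).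
    2: rewrite PSeries_1 Rmult_1_l //.
    apply (filterlim_ext (fun y => y * PSeries (inv_pow (S (S s))) y)).
    intros; rewrite Li_PSeries //.
    apply (filterlim_Rmult (fun y => y)).
    apply (filterlim_at_left_continuous (fun y => y)), continuous_id.
    apply PSeries_left_continuous_1, ex_series_inv_pow. lia.
Qed.

Lemma exp_Li_1 (x : R) : 0 < x -> exp_Li 1 x = - ln (1 - exp (- (2 * PI * x))).
Proof.
  intros Hx. apply Li_1. pose proof (exp_neg_bounds x Hx). rewrite Rabs_pos_eq; lra.
Qed.

(** The polylogarithm sum multiplied by [x ^ n]. The separate upper limit [N] allows induction on
    the number of terms while [n] stays fixed. *)
Definition Li_sum (n N : nat) (x : R) : R :=
  sum_n_m (fun j => x ^ (n - j) * exp_Li (j + 1) x / (INR (Factorial.fact (n - j)) * (2 * PI) ^ j)) 1 N.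

(** The boundary terms of a telescoping derivative: the [j]-th term of [Li_sum] has derivative
    [Li_rest n j - Li_rest n (j - 1)]. The value 0 at [N = n] reflects that [x ^ 0] has derivative
    0. *)
Definition Li_rest (n N : nat) (x : R) : R :=
  match (n - N)%nat with
  | O => 0
  | S p => x ^ p * exp_Li (N + 1) x / (INR (Factorial.fact p) * (2 * PI) ^ N)
  end.

Lemma is_derive_Li_sum (n N : nat) (x : R) : (N <= n)%nat -> 0 < x ->
  is_derive (Li_sum n N) x (Li_rest n N x - Li_rest n 0 x).
Proof.
  intros HN Hx. induction N as [|N IH].
  - rewrite Rminus_diag.
    apply (is_derive_ext (fun _ => 0)).
    intros; unfold Li_sum; rewrite sum_n_m_zero //; lia.
    apply: is_derive_const.
  - specialize (IH ltac:(lia)).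
    apply (is_derive_ext (fun y => Li_sum n N y +
      y ^ (n - S N) * exp_Li (S N + 1) y / (INR (Factorial.fact (n - S N)) * (2 * PI) ^ S N))).
    { intros y. unfold Li_sum. rewrite sum_n_Sm //. lia. }
    replace (Li_rest n (S N) x - Li_rest n 0 x) with
      ((Li_rest n N x - Li_rest n 0 x) + (Li_rest n (S N) x - Li_rest n N x)) by ring.
    apply: is_derive_plus. exact IH.
    unfold Li_rest. replace (n - N)%nat with (S (n - S N)) by lia.
    set (p := (n - S N)%nat). pose proof PI_RGT_0.
    assert (Hp : (2 * PI) ^ N <> 0) by (apply pow_nonzero; lra).
    assert (Hf := INR_fact_neq_0).
    replace (S N + 1)%nat with (S (N + 1)) by lia.
    assert (D := is_derive_exp_Li (N + 1) x Hx).
    auto_derive. eexists; exact D.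
    rewrite (is_derive_unique _ _ _ D).
    destruct p as [|p].
    + simpl. field. split; auto; lra.
    + change (pred (S p)) with p. rewrite fact_simpl mult_INR -!tech_pow_Rmult.
      pose proof (INR_S_ge_1 p). field. repeat split; auto; lra.
Qed.

(* The closed form multiplied by [x ^ n], which removes the singularity at 0. *)
Definition closed_form (n : nat) (x : R) : R :=
  PI * x ^ (n + 1) / INR (n + 1) - x ^ n * ln (2 * PI * x) / INR n + x ^ n / INR n ^ 2
  - INR (Factorial.fact (n - 1)) * zeta (n + 1) / (2 * PI) ^ n + INR (Factorial.fact (n - 1)) * Li_sum n n x.

(** The derivative of [Li_sum n n] telescopes to a single [exp_Li 1] term, which is a logarithm. The
    term [x ^ n / n ^ 2] absorbs the [x ^ (n - 1) / n] coming from the derivative of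
    [ln (2 PI x)]. *)
Lemma is_derive_closed_form (n : nat) (x : R) : (1 <= n)%nat -> 0 < x ->
  is_derive (closed_form n) x (x ^ (n - 1) * ln (sinh (PI * x) / (PI * x))).
Proof.
  intros Hn Hx. pose proof PI_RGT_0. destruct n as [|n]; [lia|].
  assert (D := is_derive_Li_sum (S n) (S n) x (le_n _) Hx).
  assert (Hln : ln (sinh (PI * x) / (PI * x)) = PI * x - ln (2 * PI * x) - exp_Li 1 x).
  { rewrite exp_Li_1 //. pose proof (exp_neg_bounds x Hx) as He.
    assert (0 < 2 * PI * x) by nra.
    replace (PI * x) with (ln (exp (PI * x))) at 3 by apply ln_exp.
    rewrite -ln_div; auto. 2: apply exp_pos.
    unfold Rminus. rewrite Ropp_involutive -ln_mult.
    f_equal. unfold sinh. replace (- (2 * PI * x)) with (- (PI * x) + - (PI * x)) by ring.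
    rewrite exp_plus exp_Ropp. field. repeat split; try (apply Rgt_not_eq, exp_pos); lra.
    apply Rdiv_lt_0_compat; auto. apply exp_pos. lra. }
  rewrite Hln. unfold closed_form.
  replace (S n - 1)%nat with n by lia.
  assert (Hf := INR_fact_neq_0 n). pose proof (INR_S_ge_1 n).
  assert (HT : Li_rest (S n) (S n) x - Li_rest (S n) 0 x = - (x ^ n * exp_Li 1 x / INR (Factorial.fact n))).
  { unfold Li_rest. rewrite Nat.sub_diag Nat.sub_0_r. simpl. field. auto. }
  rewrite HT in D.
  auto_derive. repeat split. nra. eexists; exact D.
  rewrite (is_derive_unique _ _ _ D).
  replace (n + 1)%nat with (S n) by lia.
  change (match n with 0%nat => 1 | S _ => INR n + 1 end) with (INR (S n)).
  rewrite -!tech_pow_Rmult.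
  match goal with |- ?a = ?b => change (@eq R a b) end.
  generalize dependent (INR (S n)). intros a Ha.
  field. repeat split; auto; lra.
Qed.

(** * The generating series of zeta values *)

Definition zeta_coef (n k : nat) : R :=
  (-1) ^ k * zeta (2 * S k) / (INR (S k) * INR (2 * S k + n)).

(** Quadratic decay gives absolute convergence on the boundary, as the endpoint [x = 1] requires. *)
Lemma zeta_coef_bound (n k : nat) : Rabs (zeta_coef n k) <= zeta 2 * inv_pow 2 k.
Proof.
  unfold zeta_coef, Rdiv, inv_pow. rewrite !Rabs_mult pow_1_abs Rmult_1_l.
  destruct (zeta_bounds (2 * S k) ltac:(lia)) as [H1 H2].
  pose proof (INR_S_ge_1 k).
  assert (INR (S k) <= INR (2 * S k + n)) by (apply le_INR; lia).
  rewrite Rabs_pos_eq; [|lra].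
  rewrite Rabs_pos_eq. 2: left; apply Rinv_0_lt_compat; nra.
  apply Rmult_le_compat; try lra. left; apply Rinv_0_lt_compat; nra.
  apply Rinv_le_contravar; nra.
Qed.

Lemma ex_series_zeta_coef (n : nat) : ex_series (zeta_coef n).
Proof.
  apply (@ex_series_le R_AbsRing R_CompleteNormedModule _ (fun k => zeta 2 * inv_pow 2 k) (zeta_coef_bound n)).
  apply: ex_series_scal_l. apply ex_series_inv_pow. lia.
Qed.

Lemma zeta_coef_bounded (n k : nat) : Rabs (zeta_coef n k) <= zeta 2.
Proof.
  apply Rle_trans with (1 := zeta_coef_bound n k).
  destruct (zeta_bounds 2 (le_n _)).
  pose proof (inv_pow_bounded 2 k) as H1. apply Rabs_le_between in H1.
  rewrite -{2}(Rmult_1_r (zeta 2)). apply Rmult_le_compat_l; lra.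
Qed.

(** Coefficientwise, the operator multiplies by [n + 2 + 2 k], cancelling the factor [2 (k+1) + n]
    in the denominator. With [y = x ^ 2] it is the derivative of [zeta_sum n] divided by
    [x ^ (n + 1)]. *)
Lemma zeta_coef_ode (n : nat) (y : R) : Rabs y < 1 ->
  INR (n + 2) * PSeries (zeta_coef n) y + 2 * y * PSeries (PS_derive (zeta_coef n)) y
  = PSeries log_coef y.
Proof.
  intros Hy.
  assert (I := inside_CV_radius _ _ _ (zeta_coef_bounded n) Hy).
  rewrite Rmult_assoc -PSeries_incr_1 -!PSeries_scal -PSeries_plus.
  - apply PSeries_ext. intros k.
    unfold PS_plus, PS_scal, PS_incr_1, PS_derive.
    destruct k as [|k].
    + change (INR (n + 2) * zeta_coef n 0 + 2 * 0 = log_coef 0).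
      unfold zeta_coef, log_coef. replace (2 * 1 + n)%nat with (n + 2)%nat by lia.
      simpl INR. field. apply not_0_INR; lia.
    + change (INR (n + 2) * zeta_coef n (S k) + 2 * (INR (S k) * zeta_coef n (S k)) = log_coef (S k)).
      unfold zeta_coef, log_coef.
      replace (INR (2 * S (S k) + n)) with (INR (n + 2) + 2 * INR (S k)).
      2: { replace (2 * S (S k) + n)%nat with (n + 2 + 2 * S k)%nat by lia.
           rewrite (plus_INR (n + 2)) (mult_INR 2). simpl (INR 2). ring. }
      pose proof (pos_INR (n + 2)). pose proof (INR_S_ge_1 k). pose proof (INR_S_ge_1 (S k)).
      generalize dependent (INR (n + 2)). generalize dependent (INR (S (S k))).
      generalize dependent (INR (S k)). intros a Ha b Hb c Hc.
      field. lra.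
  - apply: ex_pseries_scal. apply Rmult_comm. apply CV_radius_inside, I.
  - apply: ex_pseries_scal. apply Rmult_comm. apply: ex_pseries_incr_1. apply ex_pseries_derive, I.
Qed.

(** This is [x ^ n G x]; the two extra powers of [x] come from the series in [G] starting at
    [x ^ 2]. *)
Definition zeta_sum (n : nat) (x : R) : R := x ^ (n + 2) * PSeries (zeta_coef n) (x ^ 2).

Lemma is_derive_zeta_sum (n : nat) (x : R) : (1 <= n)%nat -> 0 < x < 1 ->
  is_derive (zeta_sum n) x (x ^ (n - 1) * ln (sinh (PI * x) / (PI * x))).
Proof.
  intros Hn Hx.
  assert (Hq : Rabs (x ^ 2) < 1) by (rewrite Rabs_pos_eq; nra).
  assert (D := is_derive_PSeries _ _ (inside_CV_radius _ _ _ (zeta_coef_bounded n) Hq)).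
  rewrite -(log_series_eq x Hx) -(zeta_coef_ode n) //.
  unfold zeta_sum. destruct n as [|n]; [lia|].
  set (c := zeta_coef (S n)) in *.
  evar_last.
  apply: is_derive_mult. 3: intros; apply Rmult_comm.
  apply is_derive_pow, is_derive_id.
  apply (is_derive_comp (PSeries c) (fun x => x ^ 2)). exact D.
  apply is_derive_pow, is_derive_id.
  unfold plus, mult, scal, one; simpl. unfold mult; simpl.
  replace (n - 0)%nat with n by lia.
  replace (n + 2)%nat with (S (S n)) by lia.
  change (match (S (S n)) with 0%nat => 1 | S _ => INR (S (S n)) + 1 end) with (INR (S (S (S n)))).
  simpl pow. ring.
Qed.

(** * Limits at the endpoints 0 and 1 *)

Lemma filterlim_pow_S_at_0 (p : nat) : filterlim (fun x => x ^ S p) (at_right 0) (locally 0).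
Proof.
  replace 0 with (0 ^ S p) at 2 by (simpl; ring).
  apply (filterlim_at_right_continuous (fun x => x ^ S p)).
  apply: ex_derive_continuous. auto_derive. trivial.
Qed.

Lemma filterlim_x_ln_at_0 : filterlim (fun x => x * ln x) (at_right 0) (locally 0).
Proof.
  assert (H : filterlim (fun x => - (ln (/ x) / / x)) (at_right 0) (locally 0)).
  { replace 0 with (- 0) at 2 by ring.
    apply (filterlim_comp _ _ _ (fun x => ln (/ x) / / x) Ropp _ (locally 0)). 2: apply: filterlim_opp.
    apply (filterlim_comp _ _ _ Rinv (fun y => ln y / y) _ (Rbar_locally p_infty)).
    apply filterlim_Rinv_0_right. apply is_lim_div_ln_p. }
  apply: filterlim_ext_loc H.
  exists (mkposreal 1 Rlt_0_1). intros y _ Hy. rewrite ln_Rinv //. field. lra.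
Qed.

(** Every term with [j < n] carries a positive power of [x] and a bounded polylogarithm; only
    [j = n] survives. *)
Lemma Li_sum_at_0 (n : nat) : (1 <= n)%nat ->
  filterlim (Li_sum n n) (at_right 0) (locally (zeta (n + 1) / (2 * PI) ^ n)).
Proof.
  intros Hn. destruct n as [|n]; [lia|].
  pose proof PI_RGT_0.
  assert (P : forall N, (N <= n)%nat -> filterlim (Li_sum (S n) N) (at_right 0) (locally 0)).
  { induction N as [|N IH]; intros HN.
    - apply (filterlim_ext (fun _ => 0)).
      intros; unfold Li_sum; rewrite sum_n_m_zero //; lia.
      apply filterlim_const.
    - apply (filterlim_ext (fun y => Li_sum (S n) N y +
        y ^ S (n - S N) * (exp_Li (S (S N)) y * / (INR (Factorial.fact (S n - S N)) * (2 * PI) ^ S N)))).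
      { intros y. unfold Li_sum. rewrite (sum_n_Sm _ 1 N); [|lia].
        replace (S (n - S N)) with (S n - S N)%nat by lia.
        replace (S N + 1)%nat with (S (S N)) by lia.
        unfold plus; simpl plus. unfold Rdiv. rewrite Rmult_assoc //. }
      replace (locally 0) with (locally (0 + 0 * (zeta (S (S N)) * / (INR (Factorial.fact (S n - S N)) * (2 * PI) ^ S N)))) by (f_equal; ring).
      apply filterlim_Rplus. apply IH; lia.
      apply filterlim_Rmult. apply filterlim_pow_S_at_0.
      apply filterlim_Rmult. apply exp_Li_at_0. apply filterlim_const. }
  apply (filterlim_ext (fun y => Li_sum (S n) n y + exp_Li (S (S n)) y * / (2 * PI) ^ S n)).
  { intros y. unfold Li_sum. rewrite (sum_n_Sm _ 1 n); [|lia].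
    rewrite Nat.sub_diag. replace (S n + 1)%nat with (S (S n)) by lia.
    simpl (y ^ 0). simpl (Factorial.fact 0). simpl (INR 1). rewrite !Rmult_1_l. reflexivity. }
  replace (S n + 1)%nat with (S (S n)) by lia.
  replace (zeta (S (S n)) / _) with (0 + zeta (S (S n)) * / (2 * PI) ^ S n) by (unfold Rdiv; ring).
  apply filterlim_Rplus. apply P; lia. apply filterlim_Rmult. apply exp_Li_at_0. apply filterlim_const.
Qed.

(** The constant zeta term is exactly what cancels the limit of the polylogarithm sum; all other
    terms tend to 0. *)
Lemma closed_form_at_0 (n : nat) : (1 <= n)%nat ->
  filterlim (closed_form n) (at_right 0) (locally 0).
Proof.
  intros Hn. assert (HL := Li_sum_at_0 n Hn). destruct n as [|n]; [lia|].
  pose proof PI_RGT_0.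
  set (f := INR (Factorial.fact (S n - 1))).
  set (Z := zeta (S n + 1) / (2 * PI) ^ S n) in *.
  (* One factor [x] is kept with [ln x], since the remaining [x ^ n] tends to 1 when [n = 0]. *)
  apply (filterlim_ext_loc (fun x => PI / INR (S n + 1) * x ^ S (S n)
    + (- / INR (S n) * (x ^ n * (x * ln x))
    + ((/ INR (S n) ^ 2 - ln (2 * PI) / INR (S n)) * x ^ S n
    + (- (f * Z) + f * Li_sum (S n) (S n) x))))).
  { exists (mkposreal 1 Rlt_0_1). intros y _ Hy. unfold closed_form, Z. fold f.
    rewrite (ln_mult (2 * PI) y) //; [|lra].
    replace (S n + 1)%nat with (S (S n)) by lia.
    rewrite -!tech_pow_Rmult.
    pose proof (INR_S_ge_1 n). pose proof (INR_S_ge_1 (S n)).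
    field. repeat split; try lra. apply pow_nonzero; lra. }
  replace (locally 0) with (locally (PI / INR (S n + 1) * 0 + (- / INR (S n) * (0 ^ n * 0)
    + ((/ INR (S n) ^ 2 - ln (2 * PI) / INR (S n)) * 0 + (- (f * Z) + f * Z))))) by (f_equal; ring).
  repeat apply filterlim_Rplus; repeat apply filterlim_Rmult; try apply filterlim_const; auto.
  - apply filterlim_pow_S_at_0.
  - apply (filterlim_at_right_continuous (fun x => x ^ n)). apply: ex_derive_continuous. auto_derive. trivial.
  - apply filterlim_x_ln_at_0.
  - apply filterlim_pow_S_at_0.
Qed.

Lemma zeta_sum_at_0 (n : nat) : filterlim (zeta_sum n) (at_right 0) (locally 0).
Proof.
  replace (locally 0) with (locally (0 * PSeries (zeta_coef n) (0 ^ 2))) by (f_equal; ring).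
  apply (filterlim_Rmult (fun x => x ^ (n + 2))).
  - replace (n + 2)%nat with (S (S n)) by lia. apply filterlim_pow_S_at_0.
  - apply (filterlim_at_right_continuous (fun x => PSeries (zeta_coef n) (x ^ 2))).
    apply (continuous_comp (fun x => x ^ 2) (PSeries (zeta_coef n))).
    apply: ex_derive_continuous. auto_derive. trivial.
    apply continuity_pt_filterlim, PSeries_continuity.
    apply (inside_CV_radius _ _ _ (zeta_coef_bounded n)).
    rewrite Rabs_pos_eq; simpl; lra.
Qed.

Lemma zeta_sum_at_1 (n : nat) : filterlim (zeta_sum n) (at_left 1) (locally (zeta_sum n 1)).
Proof.
  apply (filterlim_Rmult (fun x => x ^ (n + 2))).
  - apply (filterlim_at_left_continuous (fun x => x ^ (n + 2))).
    apply: ex_derive_continuous. auto_derive. trivial.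
  - rewrite pow1.
    apply (filterlim_comp _ _ _ (fun x => x ^ 2) (PSeries (zeta_coef n)) _ (at_left 1)).
    2: apply PSeries_left_continuous_1, ex_series_zeta_coef.
    intros P [d Hd].
    assert (Hc : continuous (fun x => x ^ 2) 1).
    { apply: ex_derive_continuous. auto_derive. trivial. }
    destruct (Hc (ball 1 d)) as [d' Hd'].
    { rewrite pow1. apply locally_ball. }
    (* The cap at 1 keeps [y] positive, so that [y < 1] implies [y ^ 2 < 1]. *)
    exists (mkposreal (Rmin d' 1) (Rmin_pos _ _ (cond_pos d') Rlt_0_1)).
    intros y Hy Hy1.
    assert (B1 : Rabs (y - 1) < Rmin d' 1) by exact Hy.
    apply Hd. apply Hd'.
    apply Rlt_le_trans with (1 := B1). apply Rmin_l.
    assert (Rabs (y - 1) < 1) by (apply Rlt_le_trans with (1 := B1); apply Rmin_r).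
    apply Rabs_lt_between in H. nra.
Qed.

(** The difference has zero derivative on the open interval and limit 0 at [0], hence vanishes
    there; left continuity of both sides extends this to [x = 1]. *)
Lemma zeta_sum_eq (n : nat) (x : R) : (1 <= n)%nat -> 0 < x <= 1 ->
  zeta_sum n x = closed_form n x.
Proof.
  intros Hn.
  set (D t := zeta_sum n t + -1 * closed_form n t).
  assert (HD : forall t, 0 < t < 1 -> is_derive D t 0).
  { intros t Ht. set (l := t ^ (n - 1) * ln (sinh (PI * t) / (PI * t))).
    replace 0 with (l + -1 * l) by ring.
    apply: is_derive_plus. apply is_derive_zeta_sum; auto.
    apply: is_derive_scal. apply is_derive_closed_form; lra || auto. }
  assert (H0 : filterlim D (at_right 0) (locally 0)).
  { replace (locally 0) with (locally (0 + -1 * 0)) by (f_equal; ring).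
    apply filterlim_Rplus. apply zeta_sum_at_0.
    apply filterlim_Rmult. apply filterlim_const. apply closed_form_at_0; auto. }
  assert (HC : forall u v, 0 < u -> u <= v -> v < 1 -> D u = D v).
  { intros u v Hu Huv Hv.
    destruct (MVT_gen D u v (fun _ => 0)) as (c & _ & E).
    - intros t. rewrite Rmin_left // Rmax_right //. intros; apply HD; lra.
    - intros t. rewrite Rmin_left // Rmax_right //. intros.
      apply derivable_continuous_pt, ex_derive_Reals_0. eexists; apply HD; lra.
    - lra. }
  assert (HZ : forall v, 0 < v < 1 -> D v = 0).
  { intros v Hv.
    assert (H1 : filterlim D (at_right 0) (locally (D v))).
    { apply (filterlim_ext_loc (fun _ => D v)). 2: apply filterlim_const.
      exists (mkposreal v (proj1 Hv)). intros y Hy Hy0.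
      change (Rabs (y - 0) < v) in Hy. apply Rabs_lt_between in Hy.
      symmetry; apply HC; lra. }
    apply (filterlim_locally_unique D _ _ H1 H0). }
  intros [Hx0 [Hx1| -> ]].
  - specialize (HZ x (conj Hx0 Hx1)). unfold D in HZ. lra.
  - assert (H1 : filterlim D (at_left 1) (locally (D 1))).
    { apply filterlim_Rplus. apply zeta_sum_at_1.
      apply filterlim_Rmult. apply filterlim_const.
      apply (filterlim_at_left_continuous (closed_form n)).
      apply: ex_derive_continuous. eexists. apply is_derive_closed_form; auto using Rlt_0_1. }
    assert (H2 : filterlim D (at_left 1) (locally 0)).
    { apply (filterlim_ext_loc (fun _ => 0)). 2: apply filterlim_const.
      exists (mkposreal 1 Rlt_0_1). intros y Hy Hy1.
      change (Rabs (y - 1) < 1) in Hy. apply Rabs_lt_between in Hy.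
      symmetry; apply HZ; lra. }
    assert (E := filterlim_locally_unique D _ _ H1 H2). unfold D in E. lra.
Qed.

(** This is [zeta_sum_eq] divided by [x ^ n], with convergence included so that two such series can
    be added or subtracted. *)
Lemma zeta_coef_series (n : nat) (x : R) : (1 <= n)%nat -> 0 < x <= 1 ->
  is_series (fun k => zeta_coef n k * x ^ (2 * S k))
   (PI * x / INR (n + 1) - ln (2 * PI * x) / INR n + 1 / INR n ^ 2
    - INR (Factorial.fact (n - 1)) * zeta (n + 1) / (2 * PI * x) ^ n
    + INR (Factorial.fact (n - 1)) *
      sum_n_m (fun j => Li (j + 1) (exp (- (2 * PI * x)))
                        / (INR (Factorial.fact (n - j)) * (2 * PI * x) ^ j)) 1 n).
Proof.
  intros Hn Hx. pose proof PI_RGT_0.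
  assert (Hxn : x ^ n <> 0) by (apply pow_nonzero; lra).
  assert (HS : is_series (fun k => zeta_coef n k * x ^ (2 * S k)) (x ^ 2 * PSeries (zeta_coef n) (x ^ 2))).
  { apply (is_series_ext (fun k => x ^ 2 * (zeta_coef n k * (x ^ 2) ^ k))).
    { intros k. rewrite (pow_mult x 2 (S k)) -(tech_pow_Rmult (x ^ 2)).
      match goal with |- ?a = ?b => change (@eq R a b) end. ring. }
    apply: is_series_scal_l. apply Series_correct.
    apply (@ex_series_le R_AbsRing R_CompleteNormedModule _ (fun k => Rabs (zeta_coef n k))).
    - intros k. change (Rabs (zeta_coef n k * (x ^ 2) ^ k) <= Rabs (zeta_coef n k)).
      rewrite Rabs_mult -{2}(Rmult_1_r (Rabs (zeta_coef n k))).
      apply Rmult_le_compat_l. apply Rabs_pos.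
      rewrite Rabs_pos_eq. rewrite -(pow1 k). apply pow_incr; nra. apply pow_le; nra.
    - apply (@ex_series_le R_AbsRing R_CompleteNormedModule _ (fun k => zeta 2 * inv_pow 2 k)).
      intros k. change (Rabs (Rabs (zeta_coef n k)) <= zeta 2 * inv_pow 2 k).
      rewrite Rabs_Rabsolu. apply zeta_coef_bound.
      apply: ex_series_scal_l. apply ex_series_inv_pow. lia. }
  match goal with |- is_series _ ?l => replace l with (x ^ 2 * PSeries (zeta_coef n) (x ^ 2)); auto end.
  apply Rmult_eq_reg_l with (x ^ n); auto.
  transitivity (closed_form n x).
  - rewrite -zeta_sum_eq //. unfold zeta_sum. rewrite pow_add. ring.
  - unfold closed_form.
    match goal with |- context [sum_n_m ?f 1 n] => set (T := sum_n_m f 1 n); assert (HT : sum_n_m (fun j => x ^ n * f j) 1 n = x ^ n * T)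
        by apply (sum_n_m_mult_l (K := R_Ring)) end.
    replace (Li_sum n n x) with (x ^ n * T).
    + rewrite pow_add pow_1 (Rpow_mult_distr (2 * PI)).
      assert ((2 * PI) ^ n <> 0) by (apply pow_nonzero; lra).
      field. repeat split; auto; apply not_0_INR; lia.
    + rewrite -HT. apply sum_n_m_ext_loc.
      intros j Hj. unfold exp_Li.
      change (x ^ n * (Li (j + 1) (exp (- (2 * PI * x))) / (INR (Factorial.fact (n - j)) * (2 * PI * x) ^ j))
       = x ^ (n - j) * Li (j + 1) (exp (- (2 * PI * x))) / (INR (Factorial.fact (n - j)) * (2 * PI) ^ j)).
      replace (x ^ n) with (x ^ (n - j) * x ^ j) by (rewrite -pow_add; f_equal; lia).
      rewrite (Rpow_mult_distr (2 * PI)). field.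
      repeat split; try apply INR_fact_neq_0; apply pow_nonzero; lra.
Qed.

(** * Fibonacci and Lucas series *)

Lemma sqrt5_sq : sqrt 5 * sqrt 5 = 5.
Proof. apply sqrt_sqrt. lra. Qed.

Lemma sqrt5_bounds : 2 < sqrt 5 < 3.
Proof. pose proof sqrt5_sq. pose proof (sqrt_pos 5). split; nra. Qed.

Lemma alpha_beta : alpha * - beta = 1.
Proof. pose proof sqrt5_sq. unfold alpha, beta. lra. Qed.

Lemma binet (n : nat) :
  sqrt 5 * Fib n = alpha ^ n - beta ^ n /\ Luc n = alpha ^ n + beta ^ n.
Proof.
  assert (Ha : alpha * alpha = alpha + 1) by (pose proof sqrt5_sq; unfold alpha; lra).
  assert (Hb : beta * beta = beta + 1) by (pose proof sqrt5_sq; unfold beta; lra).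
  assert (H : (sqrt 5 * Fib n = alpha ^ n - beta ^ n /\ Luc n = alpha ^ n + beta ^ n) /\
    (sqrt 5 * Fib (S n) = alpha ^ S n - beta ^ S n /\ Luc (S n) = alpha ^ S n + beta ^ S n)).
  { induction n as [|n [[F0 L0] [F1 L1]]].
    - unfold Fib, Luc, alpha, beta; simpl. repeat split; lra.
    - split; auto.
      assert (Ea : alpha ^ S (S n) = alpha ^ S n + alpha ^ n).
      { simpl. rewrite -Rmult_assoc Ha. ring. }
      assert (Eb : beta ^ S (S n) = beta ^ S n + beta ^ n).
      { simpl. rewrite -Rmult_assoc Hb. ring. }
      rewrite Ea Eb.
      change (Fib (S (S n))) with (Fib (S n) + Fib n). change (Luc (S (S n))) with (Luc (S n) + Luc n).
      split. rewrite Rmult_plus_distr_l F0 F1. ring. rewrite L0 L1. ring. }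
  apply H.
Qed.

(** * Convergence forces [alpha * z <= 1] *)

Lemma even_pow_nonneg (x : R) (k : nat) : 0 <= x ^ (2 * k).
Proof. rewrite pow_mult. apply pow_le, pow2_ge_0. Qed.

Lemma even_pow_opp (x : R) (k : nat) : (- x) ^ (2 * k) = x ^ (2 * k).
Proof. rewrite !pow_mult. f_equal. ring. Qed.

(* The general term of a convergent series is bounded, so [y ^ 2] is at most
   the radius of convergence 1 of the power series with coefficients [zeta_coef n]. *)
Lemma le_1_of_bounded (n : nat) (y M : R) : 0 < y ->
  (forall k, Rabs (zeta_coef n k) * y ^ (2 * S k) <= M) -> y <= 1.
Proof.
  intros Hy HM.
  (* Since zeta values are at least 1, [c k <= Rabs (zeta_coef n k)]; the ratio test is simpler for
     [c], which has no zeta factor. *)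
  set (c k := / (INR (S k) * INR (2 * S k + n))).
  assert (Pc : forall k, 0 < c k).
  { intros k. apply Rinv_0_lt_compat, Rmult_lt_0_compat; apply lt_0_INR; lia. }
  assert (HR : CV_radius c = Finite (/ 1)).
  { apply CV_radius_finite_DAlembert.
    intros k; apply Rgt_not_eq, Pc. lra.
    assert (Hi : is_lim_seq (fun k => / INR (S k)) 0).
    { apply (is_lim_seq_incr_1 (fun n => / INR n)), (is_lim_seq_inv INR p_infty).
      apply is_lim_seq_INR. easy. }
    (* The ratio [c (k+1) / c k] expressed through [1 / (k+1)], so that its limit 1 can be read
       off. *)
    apply (is_lim_seq_ext (fun k => / ((1 + / INR (S k)) * ((1 + 2 * (/ INR (S k) * / (2 + INR n * / INR (S k)))))))).
    - intros k. pose proof (INR_S_ge_1 k). pose proof (pos_INR n).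
      rewrite Rabs_pos_eq. 2: left; apply Rdiv_lt_0_compat; apply Pc.
      unfold c.
      assert (HI : forall m, INR (2 * m + n) = 2 * INR m + INR n).
      { intros m. rewrite plus_INR (mult_INR 2) //. }
      rewrite !HI (S_INR (S k)).
      generalize dependent (INR (S k)). intros a Ha. field. nra.
    - replace (Finite 1) with (Finite (/ ((1 + 0) * (1 + 2 * (0 * / (2 + INR n * 0))))))
        by (f_equal; field).
      apply (is_lim_seq_inv _ (Finite _)). 2: { intros E. injection E. lra. }
      apply is_lim_seq_mult'. apply is_lim_seq_plus'; auto. apply is_lim_seq_const.
      apply is_lim_seq_plus'. apply is_lim_seq_const.
      apply is_lim_seq_mult'. apply is_lim_seq_const.
      apply is_lim_seq_mult'; auto.
      apply (is_lim_seq_inv _ (Finite _)). 2: { intros E. injection E. lra. }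
      apply is_lim_seq_plus'. apply is_lim_seq_const.
      apply is_lim_seq_mult'; auto. apply is_lim_seq_const. }
  assert (H : Rbar_le (y ^ 2) (CV_radius c)).
  { apply (proj1 (CV_radius_bounded c)). exists (M / y ^ 2). intros k.
    assert (Hy2 : 0 < y ^ 2) by nra.
    apply Rmult_le_reg_r with (y ^ 2); auto.
    replace (M / y ^ 2 * y ^ 2) with M by (field; lra).
    apply Rle_trans with (2 := HM k).
    rewrite (pow_mult y 2 (S k)) -(tech_pow_Rmult (y ^ 2)).
    assert (Hk : 0 <= (y ^ 2) ^ k) by (apply pow_le; lra).
    rewrite Rabs_mult (Rabs_pos_eq (_ ^ k)) // (Rabs_pos_eq (c k)). 2: left; apply Pc.
    unfold zeta_coef, Rdiv. fold (c k). rewrite !Rabs_mult pow_1_abs (Rabs_pos_eq (c k)). 2: left; apply Pc.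
    destruct (zeta_bounds (2 * S k) ltac:(lia)) as [H1 _].
    rewrite Rabs_pos_eq; [|lra].
    assert (0 <= c k * (y ^ 2 * (y ^ 2) ^ k)).
    { apply Rmult_le_pos. left; apply Pc. apply Rmult_le_pos; lra. }
    nra. }
  rewrite HR Rinv_1 in H. simpl in H. nra.
Qed.

Lemma bounded_of_ex_series (a : nat -> R) : ex_series a -> exists M, forall k, Rabs (a k) <= M.
Proof.
  intros Ha. apply ex_series_lim_0 in Ha.
  destruct (filterlim_bounded a) as [M HM]. exists 0. exact Ha.
  exists M. exact HM.
Qed.

(** Covers Fibonacci and Lucas numbers at once: up to a bounded error, [w] controls the even powers
    of [alpha], so bounded terms of the [w]-series give bounded terms for [alpha * z]. *)
Lemma alpha_mul_le_1 (n : nat) (z C : R) (w : nat -> R) : 0 < z -> z <= 1 ->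
  (forall k, alpha ^ (2 * S k) <= C * w k + 1) -> 0 < C ->
  ex_series (fun k => zeta_coef n k * (w k * z ^ (2 * S k))) -> alpha * z <= 1.
Proof.
  intros Hz0 Hz1 Hw HC Hs.
  destruct (bounded_of_ex_series _ Hs) as [M HM].
  assert (Ha : 0 < alpha) by (pose proof sqrt5_bounds; unfold alpha; lra).
  (* [C * M] bounds the contribution of [C * w k]; [zeta 2] bounds that of the summand 1, because
     [z <= 1]. *)
  apply (le_1_of_bounded n _ (C * M + zeta 2)). apply Rmult_lt_0_compat; auto.
  intros k. specialize (HM k). rewrite Rabs_mult (Rabs_mult (w k)) in HM.
  assert (P := even_pow_nonneg z (S k)). rewrite (Rabs_pos_eq (z ^ _)) // in HM.
  rewrite Rpow_mult_distr.
  assert (H1 : z ^ (2 * S k) <= 1) by (rewrite -(pow1 (2 * S k)); apply pow_incr; lra).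
  assert (B := zeta_coef_bounded n k). assert (A0 := Rabs_pos (zeta_coef n k)).
  set (A := Rabs (zeta_coef n k)) in *. set (Z := z ^ (2 * S k)) in *.
  apply Rle_trans with (A * ((C * Rabs (w k) + 1) * Z)).
  - apply Rmult_le_compat_l; auto. apply Rmult_le_compat_r; auto.
    apply Rle_trans with (1 := Hw k). pose proof (Rle_abs (w k)). nra.
  - assert (A * Z <= A * 1) by (apply Rmult_le_compat_l; auto).
    assert (C * (A * (Rabs (w k) * Z)) <= C * M) by (apply Rmult_le_compat_l; lra). lra.
Qed.

(** Since [- beta] is the inverse of [alpha], this turns the [sinh] and [cosh] of the theorem into
    combinations of powers. *)
Lemma exp_n_ln_alpha (n : nat) : exp (INR n * ln alpha) = alpha ^ n /\ exp (- (INR n * ln alpha)) = (- beta) ^ n.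
Proof.
  assert (Ha : 0 < alpha) by (pose proof sqrt5_bounds; unfold alpha; lra).
  assert (E : exp (INR n * ln alpha) = alpha ^ n).
  { rewrite -ln_pow // exp_ln //. apply pow_lt; auto. }
  split; auto. rewrite exp_Ropp E -pow_inv. f_equal.
  apply Rmult_eq_reg_l with alpha; [|lra]. rewrite alpha_beta. field; lra.
Qed.
Lemma golden_bounds : 1 < alpha /\ -1 < beta < 0.
Proof. pose proof sqrt5_bounds. unfold alpha, beta. lra. Qed.


(** The series at [x = a z], with inverse powers of [a] written as powers of [b]. The pair [(a, b)]
    will be [(alpha, - beta)] and [(- beta, alpha)], which is why [alpha ^ j] accompanies the
    polylogarithm containing [beta]. *)
Lemma zeta_coef_series_scaled (n : nat) (z a b : R) : (1 <= n)%nat -> 0 < z ->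
  0 < a -> a * b = 1 -> a * z <= 1 ->
  is_series (fun k => zeta_coef n k * (a ^ (2 * S k) * z ^ (2 * S k)))
   (PI * a * z / INR (n + 1) - (ln a + ln (2 * PI * z)) / INR n + 1 / INR n ^ 2
    - INR (Factorial.fact (n - 1)) * zeta (n + 1) * b ^ n / (2 * PI * z) ^ n
    + INR (Factorial.fact (n - 1)) *
      sum_n_m (fun j => b ^ j * Li (j + 1) (exp (- (2 * PI * (a * z))))
                        / (INR (Factorial.fact (n - j)) * (2 * PI * z) ^ j)) 1 n).
Proof.
  intros Hn Hz Ha Hab Haz. pose proof PI_RGT_0.
  assert (Haz0 : 0 < a * z) by (apply Rmult_lt_0_compat; auto).
  assert (Eb : b = / a) by (apply Rmult_eq_reg_l with a; [rewrite Hab; field|]; lra).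
  assert (Einv : forall j, / (2 * PI * (a * z)) ^ j = b ^ j * / (2 * PI * z) ^ j).
  { intros j. rewrite Eb pow_inv -Rinv_mult -Rpow_mult_distr. f_equal; f_equal; ring. }
  eapply is_series_ext.
  2: { match goal with |- is_series _ ?l => replace l with
    (PI * (a * z) / INR (n + 1) - ln (2 * PI * (a * z)) / INR n + 1 / INR n ^ 2
    - INR (Factorial.fact (n - 1)) * zeta (n + 1) / (2 * PI * (a * z)) ^ n
    + INR (Factorial.fact (n - 1)) *
      sum_n_m (fun j => Li (j + 1) (exp (- (2 * PI * (a * z))))
                        / (INR (Factorial.fact (n - j)) * (2 * PI * (a * z)) ^ j)) 1 n) end.
       apply (zeta_coef_series n (a * z) Hn). lra.
       replace (2 * PI * (a * z)) with (a * (2 * PI * z)) at 1 by ring.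
       rewrite ln_mult //; [|nra]. unfold Rdiv. rewrite Einv.
       f_equal. ring. f_equal. apply sum_n_m_ext_loc. intros j Hj.
       rewrite !Rinv_mult Einv.
       match goal with |- ?a = ?b => change (@eq R a b) end. ring. }
  intros k. cbv beta. rewrite Rpow_mult_distr //.
Qed.

Lemma sum_n_m_linear_div (u v d : nat -> R) (c : R) (p q : nat) :
  sum_n_m (fun j => (u j + c * v j) / d j) p q
  = sum_n_m (fun j => u j / d j) p q + c * sum_n_m (fun j => v j / d j) p q.
Proof.
  assert (E : c * sum_n_m (fun j => v j / d j) p q = sum_n_m (fun j => c * (v j / d j)) p q)
    by (symmetry; apply (sum_n_m_mult_l (K := R_Ring))).
  rewrite E. symmetry.
  etransitivity. symmetry. apply (sum_n_m_plus (G := R_AbelianMonoid)).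
  apply sum_n_m_ext. intros j. unfold plus, Rdiv; simpl.
  match goal with |- ?a = ?b => change (@eq R a b) end. ring.
Qed.

(** The index is shifted by one, so [S k] plays the role of the summation index. Convergence is
    assumed because the series diverge for [alpha * z > 1]. For negative [z] the polylogarithm
    arguments would exceed 1. *)
Theorem theorem16 (n : nat) (z : R) (hn : (1 <= n)%nat) (hz0 : 0 < z) (hz1 : z <= 1) :
  (ex_series (fun k => (-1) ^ k * Fib (2 * S k) * zeta (2 * S k) * z ^ (2 * S k)
                         / (INR (S k) * INR (2 * S k + n))) ->
   sqrt 5 * Series (fun k => (-1) ^ k * Fib (2 * S k) * zeta (2 * S k) * z ^ (2 * S k)
                         / (INR (S k) * INR (2 * S k + n)))
   = PI * z / INR (n + 1) - 2 * ln alpha / INR n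
     + 2 * INR (Factorial.fact (n - 1)) * sinh (INR n * ln alpha) / (2 * PI * z) ^ n * zeta (n + 1)
     - INR (Factorial.fact (n - 1)) *
       sum_n_m (fun j => (alpha ^ j * Li (j + 1) (exp (2 * PI * beta * z))
                          - (- beta) ^ j * Li (j + 1) (exp (- 2 * PI * alpha * z)))
                         / (INR (Factorial.fact (n - j)) * (2 * PI * z) ^ j)) 1 n)
  /\
  (ex_series (fun k => (-1) ^ k * Luc (2 * S k) * zeta (2 * S k) * z ^ (2 * S k)
                         / (INR (S k) * INR (2 * S k + n))) ->
   Series (fun k => (-1) ^ k * Luc (2 * S k) * zeta (2 * S k) * z ^ (2 * S k)
                         / (INR (S k) * INR (2 * S k + n)))
   = sqrt 5 * PI * z / INR (n + 1) - 2 * ln (2 * PI * z) / INR n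
     - 2 * INR (Factorial.fact (n - 1)) * cosh (INR n * ln alpha) / (2 * PI * z) ^ n * zeta (n + 1)
     + 2 / INR n ^ 2
     + INR (Factorial.fact (n - 1)) *
       sum_n_m (fun j => (alpha ^ j * Li (j + 1) (exp (2 * PI * beta * z))
                          + (- beta) ^ j * Li (j + 1) (exp (- 2 * PI * alpha * z)))
                         / (INR (Factorial.fact (n - j)) * (2 * PI * z) ^ j)) 1 n).

Proof.
  destruct golden_bounds as [Ha Hb]. pose proof alpha_beta as Hab. pose proof PI_RGT_0 as HPI.
  destruct (exp_n_ln_alpha n) as [He1 He2].
  assert (Hlnb : ln (- beta) = - ln alpha).
  { replace (- beta) with (/ alpha). apply ln_Rinv; lra.
    apply Rmult_eq_reg_l with alpha; [|lra]. rewrite Hab. field; lra. }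
  (* The series at [- beta * z] converges for every [z] considered; the one at [alpha * z] needs the
     bound extracted from convergence, so [SA] stays conditional on it. *)
  assert (Hbz : - beta * z <= 1) by nra.
  assert (SB := zeta_coef_series_scaled n z (- beta) alpha hn hz0 ltac:(lra) ltac:(lra) Hbz).
  assert (SA := fun H => zeta_coef_series_scaled n z alpha (- beta) hn hz0 ltac:(lra) Hab H).
  replace (exp (- (2 * PI * (- beta * z)))) with (exp (2 * PI * beta * z)) in SB by (f_equal; ring).
  replace (exp (- (2 * PI * (alpha * z)))) with (exp (- 2 * PI * alpha * z)) in SA by (f_equal; ring).
  rewrite Hlnb in SB.
  (* These give the linear terms: the sum for Lucas, the difference for Fibonacci. The logarithms
     behave oppositely: [ln alpha] doubles in the difference and cancels in the sum. *)
  assert (HpS : alpha + - beta = sqrt 5) by (unfold alpha, beta; lra).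
  assert (HpD : alpha - - beta = 1) by (unfold alpha, beta; lra).
  assert (Hb1 : forall k, (- beta) ^ (2 * S k) <= 1).
  { intros k. rewrite -(pow1 (2 * S k)). apply pow_incr. lra. }
  assert (H5 := sqrt5_bounds).
  assert (Hpz : 2 * PI * z <> 0) by nra.
  split; intros Hex.
  - assert (E : ex_series (fun k => zeta_coef n k * (Fib (2 * S k) * z ^ (2 * S k)))).
    { eapply ex_series_ext. 2: exact Hex. intros k. unfold zeta_coef, Rdiv.
      match goal with |- ?a = ?b => change (@eq R a b) end. ring. }
    assert (Haz : alpha * z <= 1).
    (* By Binet, [alpha ^ (2 k) = sqrt 5 * Fib (2 k) + beta ^ (2 k)], and the last power is at most
       1. *)
    { apply (alpha_mul_le_1 n z (sqrt 5) (fun k => Fib (2 * S k))); auto; try lra.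
      intros k. rewrite (proj1 (binet _)). specialize (Hb1 k). rewrite even_pow_opp in Hb1. lra. }
    specialize (SA Haz).
    assert (T := is_series_minus _ _ _ _ SA SB).
    rewrite -Series_scal_l.
    match type of T with is_series _ ?l => transitivity (l : R) end.
    + apply is_series_unique. eapply is_series_ext. 2: exact T.
      intros k. assert (B := proj1 (binet (2 * S k))). rewrite -(even_pow_opp beta) in B.
      unfold zeta_coef, Rdiv.
      set (A := alpha ^ _) in *. set (C := (- beta) ^ (2 * S k)) in *.
      match goal with |- plus ?a (opp ?b) = ?c => change (a + - b = c :> R) end.
      transitivity ((-1) ^ k * zeta (2 * S k) * (sqrt 5 * Fib (2 * S k)) * z ^ (2 * S k) * / (INR (S k) * INR (2 * S k + n))).
      rewrite B. ring. ring.
    + change plus with Rplus. change opp with Ropp.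
      set (SLA := sum_n_m _ 1 n). set (SLB := sum_n_m _ 1 n). set (SLC := sum_n_m _ 1 n).
      assert (HSL : SLC = SLB + -1 * SLA).
      { unfold SLA, SLB. rewrite -sum_n_m_linear_div. apply sum_n_m_ext. intros j. f_equal. ring. }
      rewrite HSL. unfold sinh. rewrite He1 He2.
      replace (PI * z / INR (n + 1)) with (PI * (alpha - - beta) * z / INR (n + 1)) by (rewrite HpD; f_equal; ring).
      match goal with |- ?a = ?b => change (@eq R a b) end.
      field. repeat split; try (apply not_0_INR; lia); apply pow_nonzero; auto; lra.
  - assert (E : ex_series (fun k => zeta_coef n k * (Luc (2 * S k) * z ^ (2 * S k)))).
    { eapply ex_series_ext. 2: exact Hex. intros k. unfold zeta_coef, Rdiv.
      match goal with |- ?a = ?b => change (@eq R a b) end. ring. }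
    assert (Haz : alpha * z <= 1).
    (* Here [alpha ^ (2 k) = Luc (2 k) - beta ^ (2 k)], which is at most [Luc (2 k)]. *)
    { apply (alpha_mul_le_1 n z 1 (fun k => Luc (2 * S k))); auto; try lra.
      intros k. rewrite (proj2 (binet _)). pose proof (even_pow_nonneg beta (S k)). lra. }
    specialize (SA Haz).
    assert (T := is_series_plus _ _ _ _ SA SB).
    match type of T with is_series _ ?l => transitivity (l : R) end.
    + apply is_series_unique. eapply is_series_ext. 2: exact T.
      intros k. assert (B := proj2 (binet (2 * S k))). rewrite -(even_pow_opp beta) in B.
      cbv beta. rewrite B. unfold zeta_coef, Rdiv.
      match goal with |- plus ?a ?b = ?c => change (a + b = c :> R) end. ring.
    + change plus with Rplus.
      set (SLA := sum_n_m _ 1 n). set (SLB := sum_n_m _ 1 n). set (SLC := sum_n_m _ 1 n).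
      assert (HSL : SLC = SLB + 1 * SLA).
      { unfold SLA, SLB. rewrite -sum_n_m_linear_div. apply sum_n_m_ext. intros j. f_equal. ring. }
      rewrite HSL -HpS. unfold cosh. rewrite He1 He2.
      match goal with |- ?a = ?b => change (@eq R a b) end.
      field. repeat split; try (apply not_0_INR; lia); apply pow_nonzero; auto; lra.
Qed.
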